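(* For every $s\ge1$ and every positive integer $l$, the vector $\tilde I^{[lp^s-1]}_{p^s}(z)\in\mathbb Z[z]^n$ is a solution of the KZ system modulo $p^s$. Moreover, for every $t=1,\dots,s$ one has $\tilde{\mathcal M}^t_{p^s}=\mathcal M^t_{p^s}$.
   Context: Let $p$ be an odd prime, $g\ge1$, $n=2g+1$, with $p>n$. Write $z=(z_1,\dots,z_n)$. For $1\le i\ne j\le n$ let $\Omega_{ij}$ be the $n\times n$ matrix whose $(i,i)$ and $(j,j)$ entries are $-1$, whose $(i,j)$ and $(j,i)$ entries are $1$, and all of whose other entries are $0$. The KZ system is the system for a column vector $I=(I_1,\dots,I_n)$ of functions of $z$: $\frac{\partial I}{\partial z_i}=\frac12\sum_{j\ne i}\frac{\Omega_{ij}}{z_i-z_j}\,I$ for $i=1,\dots,n$, together with $I_1+\dots+I_n=0$. $\pi_s$ denotes reduction modulo $p^s$. A vector $I(z)\in\mathbb Z[z]^n$ is a solution of the KZ system modulo $p^s$ if $\pi_sI\in(\mathbb Z/p^s\mathbb Z)[z]^n$ satisfies the KZ system (the differential equations being understood in $(\mathbb Z/p^s\mathbb Z)[z]$ after multiplying the $i$-th equation by $\prod_{j\ne i}(z_i-z_j)$). Quasi-constants: $f\in\mathbb Z[z]$ is a quasi-constant modulo $p^r$ if $\partial f/\partial z_i\in p^r\mathbb Z[z]$ for all $i$; these form a ring $\mathbb Z[z]_{p^r}$. For a positive integer $r$ put $M_r=(p^r-1)/2$, $\Phi_{p^r}(x,z)=\prod_{i=1}^n(x-z_i)^{M_r}$,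 expand $\Big(\frac{\Phi_{p^r}}{x-z_1},\dots,\frac{\Phi_{p^r}}{x-z_n}\Big)=\sum_iP^i_{p^r}(z)x^i$ with $P^i_{p^r}(z)\in\mathbb Z[z]^n$, and set $I^{[lp^r-1]}_{p^r}(z)=P^{lp^r-1}_{p^r}(z)$. Also substitute $x=v+z_n$ and expand $\Big(\frac{\Phi_{p^r}(v+z_n,z)}{v+z_n-z_1},\dots,\frac{\Phi_{p^r}(v+z_n,z)}{v}\Big)=\sum_i\tilde P^i_{p^r}(z)v^i$ with $\tilde P^i_{p^r}(z)\in\mathbb Z[z]^n$, and set $\tilde I^{[lp^r-1]}_{p^r}(z)=\tilde P^{lp^r-1}_{p^r}(z)$. For $1\le t\le s$ define $\mathcal M^t_{p^s}=\{\pi_s(\sum_{r=1}^t\sum_{l=1}^g c_{r,l}(z)\,p^{s-r}I^{[lp^r-1]}_{p^r}(z)) : c_{r,l}\in\mathbb Z[z]_{p^r}\}$ and $\tilde{\mathcal M}^t_{p^s}=\{\pi_s(\sum_{r=1}^t\sum_{l=1}^g c_{r,l}(z)\,p^{s-r}\tilde I^{[lp^r-1]}_{p^r}(z)) : c_{r,l}\in\mathbb Z[z]_{p^r}\}$. *)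

(* Defs.v *)
From HB Require Import structures.
From mathcomp Require Import all_boot all_order all_algebra.
From mathcomp Require Export mpoly.
Set Implicit Arguments. Unset Strict Implicit. Unset Printing Implicit Defensive.
Import Order.TTheory GRing.Theory Num.Theory.
Local Open Scope ring_scope.

Section KZ.
Variable n : nat.

Definition Omega_app {V : zmodType} (i j : 'I_n) (I : 'I_n -> V) (k : 'I_n) : V :=
  if k == i then I j - I i else if k == j then I i - I j else 0.

(* The KZ system over a commutative unit ring R (used with R = Z/p^s Z),
   the i-th differential equation multiplied by prod_{j<>i} (z_i - z_j). *)
Definition KZ_sol (R : comUnitRingType) (I : 'I_n -> {mpoly R[n]}) : Prop :=
  (forall i k : 'I_n,
     (\prod_(j < n | j != i) ('X_i - 'X_j)) * mderiv i (I k)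
     = ((2%:R : R)^-1)%:MP *
       \sum_(j < n | j != i)
          (\prod_(l < n | (l != i) && (l != j)) ('X_i - 'X_l)) * Omega_app i j I k)
  /\ \sum_(k < n) I k = 0.

Definition red (m : nat) (f : {mpoly int[n]}) : {mpoly 'Z_m[n]} :=
  map_mpoly (fun a : int => a%:~R) f.

Definition red_vec (m : nat) (I : 'I_n -> {mpoly int[n]}) : 'I_n -> {mpoly 'Z_m[n]} :=
  fun k => red m (I k).

Definition KZ_sol_mod (m : nat) (I : 'I_n -> {mpoly int[n]}) : Prop :=
  KZ_sol (red_vec m I).

Definition quasi_const (p r : nat) (f : {mpoly int[n]}) : Prop :=
  forall (i : 'I_n) (m : 'X_{1..n}), ((p ^ r)%:Z %| (mderiv i f)@_m)%Z.

Definition Mr (p r : nat) : nat := (p ^ r).-1./2.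

(* Phi_{p^r}(x + sh, z) / (x + sh - z_k)
   = prod_i (x + sh - z_i)^(M_r - [i == k]) as a polynomial in x. *)
Definition Phi_quot (p r : nat) (sh : {mpoly int[n]}) (k : 'I_n)
  : {poly {mpoly int[n]}} :=
  \prod_(i < n) ('X + (sh - 'X_i)%:P) ^+ (if i == k then (Mr p r).-1 else Mr p r).

(* P^j_{p^r}(z) (sh = 0) resp. tilde P^j_{p^r}(z) (sh = z_n), component k *)
Definition Pcoef (p r : nat) (sh : {mpoly int[n]}) (j : nat) (k : 'I_n)
  : {mpoly int[n]} := (Phi_quot p r sh k)`_j.

(* the set M^t_{p^s} (sh = 0) resp. tilde M^t_{p^s} (sh = z_n), as a predicate
   on vectors over Z/p^s Z *)
Definition Mset (p g s t : nat) (sh : {mpoly int[n]})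
  (V : 'I_n -> {mpoly 'Z_(p ^ s)[n]}) : Prop :=
  exists c : nat -> nat -> {mpoly int[n]},
    (forall r l, (1 <= r <= t)%N -> (1 <= l <= g)%N -> quasi_const p r (c r l)) /\
    forall k : 'I_n,
      V k = red (p ^ s)
        (\sum_(1 <= r < t.+1) \sum_(1 <= l < g.+1)
            c r l * ((p ^ (s - r))%:R * Pcoef p r sh (l * p ^ r).-1 k)).

End KZ.

Arguments Mset {n} p g s t sh V.

Definition zlast (g : nat) : {mpoly int[(2 * g).+1]} := 'X_(@ord_max (2 * g)).

(* Main.v *)
(* Write [f_j = x + sh - z_j], where [sh] is the shift of the variable.  The
   derivation [d/dz_i - (d sh/dz_i) d/dx] sends [f_j] to [- (j == i)] for every
   [sh], so the integrand satisfies the KZ equations up to [d/dx] of something,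
   and coefficient [l p^s - 1] of an [x]-derivative vanishes modulo [p^s].

   For the spans, [Phi_{p^a} = Phi_{p^b} G^(p^b)] when [b <= a].  The [j]-th
   coefficient of [G^(p^b)] is [p^(b - b')] times a quasi-constant modulo
   [p^b'], where [p^b' = gcd(j, p^b)].  By induction on [b], every
   [p^(s-b) P_{p^a}^{u p^b - 1}] with [b <= a] therefore lies in the span.
   Taylor expansion expresses the vectors for one shift through the
   [P_{p^r}^m] for another with coefficients [C(m, l p^r - 1) y^(m + 1 - l p^r)],
   where [p^(r-b)] divides the binomial for [p^b = gcd(m + 1, p^r)] and the
   power of [y] is quasi-constant modulo [p^b].  This is symmetric in the two
   shifts. *)
Require Import Defs.
From mathcomp Require Import all_boot all_order all_algebra.
From mathcomp Require Import mpoly ring zify.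
Import GRing.Theory.
Local Open Scope ring_scope.
Set Implicit Arguments. Unset Strict Implicit. Unset Printing Implicit Defensive.

(** * Product rules for a map satisfying the Leibniz rule *)

Section Derivation.
Context {A : comNzRingType} {D : A -> A}.
Hypothesis DM : forall x y, D (x * y) = D x * y + x * D y.

Lemma derivation1 : D 1 = 0.
Proof. by have := DM 1 1; rewrite !mulr1 mul1r -{1}[D 1]addr0 => /addrI. Qed.

Lemma derivationX x n : D (x ^+ n) = n%:R * D x * x ^+ n.-1.
Proof.
elim: n => [|n IH]; first by rewrite expr0 derivation1 !mul0r.
rewrite exprS DM IH /=; case: n {IH} => [|n] /=; first by rewrite expr0; ring.
by rewrite exprS -[in RHS]natr1; ring.
Qed.

Lemma derivation_prod (I : finType) (P : pred I) (F : I -> A) :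
  D (\prod_(i | P i) F i) =
  \sum_(i | P i) D (F i) * \prod_(j | P j && (j != i)) F j.
Proof.
have [m] := ubnP #|P|; elim: m P => // m IH P ltPm.
case: (pickP P) => [i Pi|P0]; last by rewrite !big_pred0 // derivation1.
rewrite (bigD1 i) // DM [in RHS](bigD1 i) //=; congr (_ + _).
rewrite IH; last first.
  apply: leq_trans (_ : #|P| <= m)%N; last by rewrite -ltnS.
  apply: proper_card; apply/properP; split.
    by apply/subsetP => j; rewrite !unfold_in => /andP[].
  by exists i; rewrite unfold_in /= ?eqxx ?andbF.
rewrite mulr_sumr; apply: eq_bigr => j /andP[Pj nij].
rewrite [in RHS](bigD1 i) /=; last by rewrite Pi eq_sym.
rewrite mulrCA; congr (_ * (_ * _)); apply: eq_bigl => k.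
by rewrite andbAC.
Qed.

End Derivation.

(** * Divisibility in [Z[z]] and quasi-constants *)

Section Divisibility.
Context {n : nat}.
Implicit Types (f h : {mpoly int[n]}) (d p r : nat).

Lemma mpoly_coef_dvd d f :
  (forall m, (d%:Z %| f@_m)%Z) -> exists h, f = d%:R * h.
Proof.
move=> df; exists (\sum_(m <- msupp f) (f@_m %/ d%:Z)%Z *: 'X_[m]).
rewrite {1}[f]mpolyE mulr_sumr; apply: eq_bigr => m _.
by rewrite mulr_natl scalerMnl -[_ *+ d]mulr_natr natz divzK.
Qed.

Lemma mcoeff_natM d f m : (d%:R * f)@_m = d%:Z * f@_m.
Proof. by rewrite mulr_natl mcoeffMn -mulr_natl natz. Qed.

(** Coefficientwise divisibility is traded for an explicit quotient, which ring identities can carry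
    along. *)
Lemma quasi_constP p r f :
  quasi_const p r f <-> forall i, exists h, mderiv i f = (p ^ r)%:R * h.
Proof.
split=> [qf i|qf i m]; first exact: mpoly_coef_dvd (qf i).
by have [h ->] := qf i; rewrite mcoeff_natM dvdz_mulr.
Qed.

Lemma mpoly_natMI d f h : (0 < d)%N -> d%:R * f = d%:R * h -> f = h.
Proof.
move=> d0 /mpolyP E; apply/mpolyP => m; have := E m; rewrite !mcoeff_natM.
by apply: mulfI; lia.
Qed.

Lemma quasi_const0 p r : @quasi_const n p r 0.
Proof. by apply/quasi_constP => i; exists 0; rewrite mulr0 raddf0. Qed.

Lemma quasi_constD p r f h :
  quasi_const p r f -> quasi_const p r h -> quasi_const p r (f + h).
Proof.
move=> /quasi_constP qf /quasi_constP qh; apply/quasi_constP => i.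
have [[a fa] [b hb]] := (qf i, qh i).
by exists (a + b); rewrite mderivD fa hb mulrDr.
Qed.

Lemma quasi_constM p r f h :
  quasi_const p r f -> quasi_const p r h -> quasi_const p r (f * h).
Proof.
move=> /quasi_constP qf /quasi_constP qh; apply/quasi_constP => i.
have [[a fa] [b hb]] := (qf i, qh i).
by exists (a * h + f * b); rewrite mderivM fa hb; ring.
Qed.

Lemma quasi_constW p r r' f :
  (r' <= r)%N -> quasi_const p r f -> quasi_const p r' f.
Proof.
move=> rr /quasi_constP qf; apply/quasi_constP => i; have [h ->] := qf i.
by exists ((p ^ (r - r'))%:R * h); rewrite mulrA -natrM -expnD subnKC.
Qed.

Lemma quasi_constX p r f k : (p ^ r %| k)%N -> quasi_const p r (f ^+ k).
Proof.
move=> /dvdnP[q ->]; apply/quasi_constP => i.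
exists (q%:R * mderiv i f * f ^+ (q * p ^ r).-1).
by rewrite (derivationX (@mderivM _ _ i)) natrM; ring.
Qed.

(** If [p ^ r] divides [k f], the part of [p ^ r] not absorbed by [k] divides [f]. Below, [k] is the
    index of a coefficient (or that index plus one), and [k f] is controlled by a derivative or a
    binomial identity. *)
Lemma mpoly_gauss p r k f : prime p -> (exists h, k%:R * f = (p ^ r)%:R * h) ->
  exists b h, [/\ (b <= r)%N, gcdn k (p ^ r) = (p ^ b)%N
                & f = (p ^ (r - b))%:R * h].
Proof.
move=> pp [h kf]; have p0 := prime_gt0 pp.
have [b br gE] : exists2 b, (b <= r)%N & gcdn k (p ^ r) = (p ^ b)%N.
  by apply/dvdn_pfactor => //; apply: dvdn_gcdr.
have pr0 : (0 < p ^ r)%N by rewrite expn_gt0 p0.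
(* Bezout: [u p^r = v k + p^b], and [p^r] divides [k f]. *)
have [u v uv _] := egcdnP k pr0; rewrite gcdnC gE in uv.
exists b; exists (u%:R * f - v%:R * h); split=> //.
apply: (@mpoly_natMI (p ^ b)); first by rewrite expn_gt0 p0.
rewrite mulrA -natrM -expnD subnKC //.
have -> : (p ^ b)%:R = (u * p ^ r)%:R - (v * k)%:R :> {mpoly int[n]}.
  by rewrite uv natrD addrC addKr.
by rewrite !natrM mulrBl -(mulrA v%:R) kf; ring.
Qed.

(** The factor [p ^ (r - b)] cancels from the derivatives because [Z[z]] has no torsion. *)
Lemma quasi_const_div p r b h : prime p -> (b <= r)%N ->
  quasi_const p r ((p ^ (r - b))%:R * h) -> quasi_const p b h.
Proof.
move=> pp br /quasi_constP q; apply/quasi_constP => i; have [w] := q i.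
rewrite mulr_natl mderivMn -(mulr_natl (mderiv i h)) -{2}(subnK br).
rewrite expnD natrM -mulrA => E.
by exists w; apply: mpoly_natMI E; rewrite expn_gt0 prime_gt0.
Qed.

End Divisibility.

(** * The master function and its derivatives *)

Section MasterFunction.
Context {A : comNzRingType} {I : finType} (f : I -> A) (M : nat).
Hypothesis M_gt0 : (0 < M)%N.
Implicit Types i k : I.

(* With [Phi = prod_j f_j ^ M], [master1 k = Phi / f_k] and
   [master2 i k = Phi / (f_i f_k)]. *)
Definition master1 k := \prod_j f j ^+ (if j == k then M.-1 else M).
Definition master2 i k :=
  f i ^+ M.-1 * f k ^+ M.-1 * \prod_(j | (j != i) && (j != k)) f j ^+ M.

Lemma master1_split i k : k != i ->
  master1 k =
  f i ^+ M * (f k ^+ M.-1 * \prod_(j | (j != i) && (j != k)) f j ^+ M).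
Proof.
move=> ki; rewrite /master1 (bigD1 i) //= (bigD1 k) //= eqxx.
rewrite eq_sym (negPf ki); congr (_ * (_ * _)).
by apply: eq_bigr => j /andP[_ /negPf->].
Qed.

Lemma master1E i k :
  k != i -> master1 k = f i * master2 i k /\ master1 i = f k * master2 i k.
Proof.
have fM j : f j ^+ M = f j * f j ^+ M.-1 by rewrite -exprS prednK.
move=> ki; rewrite (master1_split ki) (@master1_split k i) 1?eq_sym //.
rewrite /master2 (fM i) (fM k) -!mulrA; split=> //.
under eq_bigl do rewrite andbC.
by congr (_ * _); rewrite mulrCA.
Qed.

(** This is the partial fraction identity [1/f_i - 1/f_k = (f_k - f_i)/(f_i f_k)] multiplied by
    [Phi]. *)
Lemma master1B i k :
  k != i -> master1 i - master1 k = (f k - f i) * master2 i k.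
Proof. by move=> ki; have [-> ->] := master1E ki; rewrite mulrBl. Qed.

Section Derivation.
Context {D : A -> A}.
Hypothesis DM : forall x y, D (x * y) = D x * y + x * D y.

(** Only the factor [f_i] is moved, and for [k != i] it still has the full exponent [M] in
    [Phi / f_k]. *)
Lemma derivation_master1 i k : (forall j, D (f j) = - (j == i)%:R) ->
  k != i -> D (master1 k) = - M%:R * master2 i k.
Proof.
move=> Df ki; rewrite (master1_split ki) DM (derivationX DM) Df eqxx.
suff -> : D (f k ^+ M.-1 * \prod_(j | (j != i) && (j != k)) f j ^+ M) = 0.
  by rewrite mulr0 addr0 mulrN1 /master2 !mulrA.
rewrite DM (derivationX DM) Df (negPf ki) oppr0 mulr0 !mul0r add0r.
rewrite (derivation_prod DM) big1 ?mulr0 // => j /andP[/negPf ji _].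
by rewrite (derivationX DM) Df ji oppr0 mulr0 !mul0r.
Qed.

(** In [Phi / f_i] the factor [f_i] has exponent [M - 1]. A derivation killing [f_i] avoids
    differentiating it, so only exponents [M] come down. *)
Lemma derivation_master1_diag i : (forall j, D (f j) = (j != i)%:R) ->
  D (master1 i) = M%:R * \sum_(j | j != i) master2 i j.
Proof.
move=> Df; rewrite /master1 (bigD1 i) //= eqxx DM (derivationX DM) Df eqxx.
rewrite mulr0 !mul0r add0r (derivation_prod DM) !mulr_sumr.
apply: eq_bigr => j ji; rewrite (derivationX DM) Df ji mulr1 /master2.
rewrite (negPf ji); under eq_bigr => l /andP[/negPf-> _] do [].
by rewrite -!mulrA mulrCA.
Qed.

Lemma derivation_master : (forall j, D (f j) = 1) ->
  D (\prod_j f j ^+ M) = M%:R * \sum_k master1 k.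
Proof.
move=> Df; rewrite (derivation_prod DM) mulr_sumr.
apply: eq_bigr => k _; rewrite (derivationX DM) Df mulr1 -mulrA.
rewrite /master1 [in RHS](bigD1 k) //= eqxx.
by under [in RHS]eq_bigr => l /negPf-> do [].
Qed.

End Derivation.
End MasterFunction.

Lemma coef_natM (A : nzRingType) d (q : {poly A}) j :
  (d%:R * q)`_j = d%:R * q`_j.
Proof. by rewrite !mulr_natl coefMn. Qed.

(** * The KZ equations up to multiples of [p ^ s] *)

Section KZ_equations.
Context {n : nat} (p s : nat) (sh : {mpoly int[n]}).
Local Notation M := (Mr p s).
Local Notation Q := (Phi_quot p s sh).
Local Notation f i := ('X + (sh - 'X_i)%:P : {poly {mpoly int[n]}}).

Hypothesis M_gt0 : (0 < M)%N.

(* The total derivative along [z_i] that moves the base point of the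
   expansion with [sh]: it sends [f j] to [- (j == i)] whatever [sh] is. *)
Definition dz (i : 'I_n) (q : {poly {mpoly int[n]}}) :=
  map_poly (mderiv i) q - (mderiv i sh)%:P * q^`().

Lemma map_mderivM (i : 'I_n) (x y : {poly {mpoly int[n]}}) :
  map_poly (mderiv i) (x * y)
  = map_poly (mderiv i) x * y + x * map_poly (mderiv i) y.
Proof.
apply/polyP => j; rewrite coefD coef_map !coefM raddf_sum -big_split /=.
by apply: eq_bigr => k _; rewrite mderivM !coef_map.
Qed.

Lemma dzM i x y : dz i (x * y) = dz i x * y + x * dz i y.
Proof. by rewrite /dz map_mderivM derivM; ring. Qed.

Lemma dz_lin i j : dz i (f j) = - (j == i)%:R.
Proof.
rewrite /dz derivD derivX derivC addr0 mulr1 raddfD /=.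
have -> : map_poly (mderiv i) ('X : {poly {mpoly int[n]}}) = 0 :> {poly {mpoly int[n]}}.
  by apply/polyP => k; rewrite coef_map coefX coef0 /= -mpolyC_nat mderivC.
rewrite map_polyC /= mderivB mderivX mnm1E polyCB add0r addrAC subrr add0r.
case: eqVneq => [->|_]; last by rewrite scale0r polyC0.
have -> : (U_(i) - U_(i))%MM = 0%MM :> 'X_{1..n}.
  by apply/mnmP => k; rewrite mnmBE subnn mnm0E.
by rewrite scale1r mpolyX0.
Qed.

Lemma coef_dz i q j :
  (dz i q)`_j = mderiv i q`_j - mderiv i sh * q^`()`_j.
Proof. by rewrite /dz coefB coef_map coefCM. Qed.

Local Notation Q2 := (master2 (fun j => f j) M).

Lemma Phi_quotB i k : k != i -> Q i - Q k = ('X_i - 'X_k)%:P * Q2 i k.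
Proof.
move=> ki; rewrite (master1B (fun j => f j) M_gt0 ki); congr (_ * _).
by rewrite !polyCB opprD !addrA; ring.
Qed.

Lemma dz_Phi_quot i k : k != i -> dz i (Q k) = - M%:R * Q2 i k.
Proof. exact: (derivation_master1 M (dzM i) (dz_lin i)). Qed.

Lemma dz_Phi_quot_diag i :
  dz i (Q i) = M%:R * (\sum_(j | j != i) Q2 i j) - (Q i)^`().
Proof.
(* Adding [d/dx] kills [f i] and sends every other [f j] to 1; the correction is an
   [x]-derivative. *)
pose E q := dz i q + q^`().
have EM x y : E (x * y) = E x * y + x * E y by rewrite /E dzM derivM; ring.
have El j : E (f j) = (j != i)%:R.
  rewrite /E dz_lin derivD derivX derivC addr0.
  by case: eqVneq => _; rewrite ?addNr ?oppr0 ?add0r.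
by rewrite -(derivation_master1_diag _ EM El) addrK.
Qed.

Lemma deriv_Phi : (\prod_(j < n) f j ^+ M)^`() = M%:R * \sum_k Q k.
Proof.
apply: (derivation_master _ (@derivM _)) => j.
by rewrite derivD derivX derivC addr0.
Qed.

(** Coefficient [K - 1] of a derivative is [K] times coefficient [K], here with [K = l p^s]. *)
Lemma coef_deriv_pM (q : {poly {mpoly int[n]}}) l :
  (0 < l * p ^ s)%N -> exists h, q^`()`_(l * p ^ s).-1 = (p ^ s)%:R * h.
Proof.
move=> l0; rewrite coef_deriv prednK //; exists (l%:R * q`_(l * p ^ s)).
by rewrite -(mulr_natl q`_(l * p ^ s)) natrM mulrA (mulrC (p ^ s)%:R).
Qed.

Section Coef.
Variable l : nat.
Hypothesis l_gt0 : (0 < l * p ^ s)%N.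
Local Notation J := (l * p ^ s).-1.
Local Notation P := (Pcoef p s sh J).

Lemma Pcoef_deriv i k : k != i -> exists h,
  ('X_i - 'X_k) * mderiv i (P k) = - M%:R * (P i - P k) + (p ^ s)%:R * h.
Proof.
move=> ki; have [h Eh] := coef_deriv_pM (Q k) l_gt0.
exists (('X_i - 'X_k) * mderiv i sh * h).
have := congr1 (coefp J) (dz_Phi_quot ki); rewrite /= coef_dz Eh => E.
have := congr1 (coefp J) (Phi_quotB ki); rewrite /= coefB coefCM /Pcoef => ->.
have -> : mderiv i (Q k)`_J
  = - (M%:R * (Q2 i k)`_J) + mderiv i sh * ((p ^ s)%:R * h).
  apply/eqP; rewrite -subr_eq E; apply/eqP.
  by rewrite mulNr coefN coef_natM.
by ring.
Qed.

Lemma Pcoef_deriv_diag i : exists h,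
  mderiv i (P i)
  = M%:R * (\sum_(j | j != i) (Q2 i j)`_J) + (p ^ s)%:R * h.
Proof.
have [h Eh] := coef_deriv_pM (Q i) l_gt0.
exists (mderiv i sh * h - h).
have := congr1 (coefp J) (dz_Phi_quot_diag i); rewrite /= coef_dz coefB Eh.
rewrite coef_natM coef_sum -/(Pcoef p s sh J i) => /eqP.
by rewrite subr_eq => /eqP->; ring.
Qed.

Lemma Pcoef_sum : odd (p ^ s) -> exists h, \sum_k P k = (p ^ s)%:R * h.
Proof.
move=> ops; have [h Eh] := coef_deriv_pM (\prod_(j < n) f j ^+ M) l_gt0.
move: Eh; rewrite deriv_Phi coef_natM coef_sum => Eh.
(* As [M] times the sum is [p^s h] and [2M + 1 = p^s], the sum equals [(2M + 1)] times itself minus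
   [2 p^s h]. *)
exists (\sum_k P k - 2%:R * h).
have -> : (p ^ s)%:R = (2 * M).+1%:R :> {mpoly int[n]}.
  by congr (_%:R); rewrite /Mr; lia.
have Mp : (2 * M).+1 = (p ^ s)%N by rewrite /Mr; lia.
rewrite mulrBr (mulrCA _ 2%:R) Mp -Eh -Mp -natr1 natrM /Pcoef; ring.
Qed.

(** The factor [- M] stands for [1/2], since [2 (- M) = 1 - p^s]. *)
Lemma Pcoef_KZ i k : exists h,
  (\prod_(j < n | j != i) ('X_i - 'X_j)) * mderiv i (P k)
  = - M%:R *
    (\sum_(j < n | j != i)
       (\prod_(l < n | (l != i) && (l != j)) ('X_i - 'X_l)) * Omega_app i j P k)
    + (p ^ s)%:R * h.
Proof.
(* On the diagonal, each coefficient of [Q2 i j] is turned back into [P i - P j] by the missing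
   factor ['X_i - 'X_j]. Off it, only [j = k] contributes to row [k]. *)
have [->|ki] := eqVneq k i.
  have [h ->] := Pcoef_deriv_diag i.
  exists (\prod_(j < n | j != i) ('X_i - 'X_j) * h).
  rewrite mulrDr mulrCA [X in _ + X]mulrCA; congr (_ + _).
  rewrite mulNr -mulrN; congr (_ * _); rewrite mulr_sumr -sumrN.
  apply: eq_bigr => j ji; rewrite (bigD1 j) //= /Omega_app eqxx.
  have := congr1 (coefp J) (Phi_quotB ji); rewrite /= coefB coefCM => E.
  by rewrite -mulrN opprB /Pcoef E; ring.
have [h Eh] := Pcoef_deriv ki.
exists (\prod_(l < n | (l != i) && (l != k)) ('X_i - 'X_l) * h).
rewrite (bigD1 k) //= [\sum_(j < n | j != i) _](bigD1 k) //=.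
rewrite [\sum_(j < n | _) _]big1; last first.
  by move=> j /andP[_ /negPf jk]; rewrite /Omega_app (negPf ki) eq_sym jk mulr0.
rewrite /Omega_app (negPf ki) eqxx addr0 mulrAC Eh; ring.
Qed.

End Coef.
End KZ_equations.

(** * Compatibility of reduction modulo [m] with the operations *)

Section Reduction.
Context {n : nat} (m : nat).
Local Notation phi := (map_mpoly (intmul (1 : 'Z_m)) : {mpoly int[n]} -> _).

Lemma redE f : red m f = phi f.
Proof. by []. Qed.

Lemma redD f h : red m (f + h : {mpoly int[n]}) = red m f + red m h.
Proof. by rewrite !redE rmorphD. Qed.

Lemma redM f h : red m (f * h : {mpoly int[n]}) = red m f * red m h.
Proof. by rewrite !redE rmorphM. Qed.

Lemma redB f h : red m (f - h : {mpoly int[n]}) = red m f - red m h.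
Proof. by rewrite !redE rmorphB. Qed.

Lemma red_sum (I : finType) (P : pred I) (F : I -> {mpoly int[n]}) :
  red m (\sum_(i | P i) F i) = \sum_(i | P i) red m (F i).
Proof. by rewrite redE rmorph_sum. Qed.

Lemma red_prod (I : finType) (P : pred I) (F : I -> {mpoly int[n]}) :
  red m (\prod_(i | P i) F i) = \prod_(i | P i) red m (F i).
Proof. by rewrite redE rmorph_prod. Qed.

Lemma red_natN d : red m (- d%:R : {mpoly int[n]}) = - d%:R.
Proof. by rewrite redE rmorphN rmorph_nat. Qed.

Lemma red_modulus h : (1 < m)%N -> red m (m%:R * h : {mpoly int[n]}) = 0.
Proof.
by move=> m1; rewrite redE rmorphM rmorph_nat -mpolyC_nat pchar_Zp // mpolyC0 mul0r.
Qed.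

Lemma red_mderiv i f : mderiv i (red m f) = red m (mderiv i f : {mpoly int[n]}).
Proof.
apply/mpolyP => a; rewrite !redE mcoeff_deriv !mcoeff_map_mpoly /= mcoeff_deriv.
by rewrite rmorphMn.
Qed.

Lemma redX i : red m ('X_i : {mpoly int[n]}) = 'X_i.
Proof. by rewrite redE map_mpolyX. Qed.

Lemma red_Omega i j (I : 'I_n -> {mpoly int[n]}) k :
  Omega_app i j (red_vec m I) k = red m (Omega_app i j I k).
Proof.
by rewrite /Omega_app; case: ifP => _; [|case: ifP => _]; rewrite ?redE ?rmorphB ?rmorph0.
Qed.

End Reduction.

(** * Solutions of the KZ system over [Z/p^s] *)

Lemma Mr_gt0 p r : odd p -> (1 < p ^ r)%N -> (0 < Mr p r)%N.
Proof. by move=> op; have := oddX p r; rewrite op orbT /Mr; lia. Qed.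

Lemma Pcoef_KZ_mod n p s (sh : {mpoly int[n]}) l :
  odd p -> (1 < p ^ s)%N -> (0 < l)%N ->
  KZ_sol_mod (p ^ s) (Pcoef p s sh (l * p ^ s).-1).
Proof.
move=> op ps1 l0; have ops : odd (p ^ s) by rewrite oddX op orbT.
have M0 := Mr_gt0 op ps1.
have Mp : (2 * Mr p s).+1 = (p ^ s)%N by rewrite /Mr; lia.
have lp : (0 < l * p ^ s)%N by rewrite muln_gt0 l0; lia.
have half : (2%:R : 'Z_(p ^ s))^-1 = - (Mr p s)%:R.
  apply: mulr1_eq; rewrite mulrN -natrM.
  have: (2 * Mr p s).+1%:R = 0 :> 'Z_(p ^ s) by rewrite Mp pchar_Zp.
  by rewrite -natr1 addrC => /eqP; rewrite addr_eq0 => /eqP.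
split=> [i k|]; last first.
  have [h Eh] := Pcoef_sum sh M0 lp ops.
  by rewrite -red_sum Eh red_modulus.
have [h /(congr1 (red (p ^ s)))] := Pcoef_KZ sh M0 lp i k.
rewrite redD red_modulus // addr0 !redM red_prod red_sum red_natN -red_mderiv.
rewrite half mpolyCN mpolyC_nat; under eq_bigr do rewrite redB !redX.
move=> ->; congr (_ * _); apply: eq_bigr => j ji.
rewrite redM red_Omega red_prod; congr (_ * _).
by apply: eq_bigr => a _; rewrite redB !redX.
Qed.

(** * Spans with quasi-constant coefficients *)

Section Span.
Context {n : nat} (p g s : nat).
Hypotheses (pp : prime p) (op : odd p).
Implicit Types (sh c h : {mpoly int[n]}) (W : 'I_n -> {mpoly int[n]}).

(* [W] is congruent modulo [p ^ s] to an element of the span whose reduction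
   is [Mset p g s t sh]. *)
Definition in_span sh t W := exists (c : nat -> nat -> {mpoly int[n]}) E,
  (forall r l, quasi_const p r (c r l)) /\
  forall k, W k = \sum_(1 <= r < t.+1) \sum_(1 <= l < g.+1)
      c r l * ((p ^ (s - r))%:R * Pcoef p r sh (l * p ^ r).-1 k)
    + (p ^ s)%:R * E k.

Lemma in_span_ext sh t W W' : W =1 W' -> in_span sh t W -> in_span sh t W'.
Proof. by move=> WW [c [E [qc EW]]]; exists c, E; split=> // k; rewrite -WW. Qed.

Lemma in_span_pM sh t W : in_span sh t (fun k => (p ^ s)%:R * W k).
Proof.
exists (fun _ _ => 0), W; split=> [r l|k]; first exact: quasi_const0.
by rewrite big1 ?add0r // => r _; rewrite big1 // => l _; rewrite mul0r.
Qed.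

Lemma in_span0 sh t : in_span sh t (fun=> 0).
Proof.
apply: in_span_ext (in_span_pM sh t (fun=> 0)) => k.
by rewrite mulr0.
Qed.

Lemma in_spanD sh t W W' : in_span sh t W -> in_span sh t W' ->
  in_span sh t (fun k => W k + W' k).
Proof.
move=> [c [E [qc EW]]] [c' [E' [qc' EW']]].
exists (fun r l => c r l + c' r l), (fun k => E k + E' k).
split=> [r l|k]; first exact: quasi_constD.
rewrite EW EW' mulrDr addrACA; congr (_ + _).
rewrite -big_split; apply: eq_bigr => r _.
by rewrite -big_split; apply: eq_bigr => l _; rewrite mulrDl.
Qed.

Lemma in_span_sum sh t (I : eqType) (rI : seq I)
    (F : I -> 'I_n -> {mpoly int[n]}) :
  (forall i, i \in rI -> in_span sh t (F i)) ->
  in_span sh t (fun k => \sum_(i <- rI) F i k).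
Proof.
elim: rI => [|i rI IH] Fs.
  by apply: in_span_ext (in_span0 sh t) => k; rewrite big_nil.
have Fi : in_span sh t (F i) by apply: Fs; rewrite mem_head.
have Fr := IH (fun j jr => Fs j (mem_behead (s := i :: rI) jr)).
by apply: in_span_ext (in_spanD Fi Fr) => k; rewrite big_cons.
Qed.

Lemma big_nat_only (A : nmodType) a b j (F : nat -> A) : (a <= j < b)%N ->
  (forall i, i != j -> F i = 0) -> \sum_(a <= i < b) F i = F j.
Proof.
move=> jab F0; rewrite (bigD1_seq j) ?mem_index_iota ?iota_uniq //=.
by rewrite big1 ?addr0.
Qed.

Lemma in_span_gen sh t r l c : (1 <= r <= t)%N -> (1 <= l <= g)%N ->
  quasi_const p r c ->
  in_span sh t (fun k => c * ((p ^ (s - r))%:R * Pcoef p r sh (l * p ^ r).-1 k)).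
Proof.
move=> rt lg qc.
exists (fun r' l' => if (r' == r) && (l' == l) then c else 0), (fun=> 0).
split=> [r' l'|k].
  by case: ifP => [/andP[/eqP->] //|_]; apply: quasi_const0.
rewrite mulr0 addr0 (@big_nat_only _ _ _ r); first last.
- by move=> r' /negPf->; rewrite big1 // => l' _; rewrite mul0r.
- by rewrite ltnS.
rewrite (@big_nat_only _ _ _ l) ?eqxx // => l' /negPf->.
by rewrite andbF mul0r.
Qed.

(** * Comparison of different powers of [p] in the master polynomial *)

(** Both derivatives of [G ^+ (p ^ b)] are multiples of [p ^ b]. The one in [x] shows that [p ^ b]
    divides [j] times the [j]-th coefficient, whence the power of [p]; those in [z_i] make the
    cofactor a quasi-constant. *)
Lemma coef_pow_pfactor b (G : {poly {mpoly int[n]}}) j :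
  exists b' h, [/\ (b' <= b)%N, gcdn j (p ^ b) = (p ^ b')%N,
    (G ^+ (p ^ b))`_j = (p ^ (b - b'))%:R * h & quasi_const p b' h].
Proof.
have qG : quasi_const p b (G ^+ (p ^ b))`_j.
  apply/quasi_constP => i; rewrite -(coef_map (mderiv i)) /=.
  rewrite (derivationX (@map_mderivM _ i)) -mulrA coef_natM.
  by eexists.
have [|b' [h [bb gE Eh]]] := @mpoly_gauss _ p b j (G ^+ (p ^ b))`_j pp.
  case: j qG => [|j] qG; first by exists 0; rewrite mul0r mulr0.
  exists (G^`() * G ^+ (p ^ b).-1)`_j.
  by rewrite -[RHS]coef_natM (mulr_natl (_ * _)) -deriv_exp coef_deriv mulr_natl.
by exists b', h; split=> //; apply: (@quasi_const_div _ p b b') => //; rewrite -Eh.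
Qed.

Lemma MrD a b : (b <= a)%N -> exists N, Mr p a = (Mr p b + N * p ^ b)%N.
Proof.
(* [(p^a - 1)/2 = (p^b - 1)/2 + p^b (p^(a-b) - 1)/2]. *)
move=> ba; exists (Mr p (a - b)); rewrite /Mr -{1}(subnK ba) expnD.
have := oddX p (a - b); have := oddX p b; rewrite op !orbT.
move: (p ^ b)%N (p ^ (a - b))%N => x y ox oy.
have {oy} -> : y = (2 * y./2).+1 by lia.
rewrite mulSn -mulnA /= !mul2n doubleK; lia.
Qed.

(** One [G] serves all [k]: for [b > 0] the exponent [Mr p b] is positive, so the missing factor is
    taken out of the [p ^ b] part. *)
Lemma Phi_quot_pow sh a b : (0 < b <= a)%N ->
  exists G, forall k, Phi_quot p a sh k = Phi_quot p b sh k * G ^+ (p ^ b).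
Proof.
case/andP=> b0 ba; have [N EN] := MrD ba.
have Mb : (0 < Mr p b)%N by rewrite Mr_gt0 // -{1}(exp1n b) ltn_exp2r ?prime_gt1.
exists (\prod_(i < n) ('X + (sh - 'X_i)%:P) ^+ N) => k.
rewrite -prodrXl /Phi_quot -big_split /=; apply: eq_bigr => i _.
rewrite -exprM -exprD EN; congr (_ ^+ _).
by case: ifP => _ //; rewrite -{1}(prednK Mb).
Qed.

Lemma size_Phi_quot sh b k : (0 < b)%N -> (0 < n)%N ->
  (size (Phi_quot p b sh k) <= n * Mr p b)%N.
Proof.
move=> b0 n0.
have Mb : (0 < Mr p b)%N by rewrite Mr_gt0 // -{1}(exp1n b) ltn_exp2r ?prime_gt1.
have -> : (n * Mr p b = (\sum_(i < n) (if i == k then (Mr p b).-1 else Mr p b)).+1)%N.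
  rewrite (bigD1 k) //= eqxx (eq_bigr (fun=> Mr p b)) => [|i /negPf-> //].
  by rewrite -addSn prednK // sum_nat_const cardC1 card_ord -{1}(prednK n0) mulSn.
rewrite /Phi_quot.
elim/big_rec2: _ => [|i m q _ IH]; first by rewrite size_poly1.
set e := (if _ then _ else _).
apply: leq_trans (size_polyMleq _ _) _.
have Se : (size (('X + (sh - 'X_i)%:P : {poly {mpoly int[n]}}) ^+ e) <= e.+1)%N.
  by apply: leq_trans (size_poly_exp_leq _ _) _; rewrite size_XaddC mul1n.
by rewrite -subn1 leq_subLR; apply: leq_trans (leq_add Se IH) _; lia.
Qed.

Hypothesis n_odd : n = (2 * g).+1.

(** The degree of [Phi / f_k] is at most [(2g + 1)(p^b - 1)/2 - 1], which is below
    [(g + 1) p^b - 1]. *)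
Lemma Pcoef_eq0 sh b l k :
  (0 < b)%N -> (g < l)%N -> Pcoef p b sh (l * p ^ b).-1 k = 0.
Proof.
move=> b0 gl; apply: nth_default; apply: leq_trans (size_Phi_quot _ _ _ _) _ => //.
  by rewrite n_odd.
have q0 : (0 < p ^ b)%N by rewrite expn_gt0 prime_gt0.
have : (g.+1 * p ^ b <= l * p ^ b)%N by rewrite leq_mul2r gl orbT.
have := oddX p b; rewrite op orbT mulSn => oq.
have : ((2 * g).+1 * Mr p b = g * (p ^ b).-1 + Mr p b)%N.
  by rewrite mulSn addnC -mulnA mulnCA; congr (_ * _ + _)%N; rewrite /Mr; lia.
rewrite n_odd => ->; move: q0 oq; rewrite /Mr => q0 oq.
have : (g * (p ^ b).-1 <= g * p ^ b)%N by rewrite leq_mul2l leq_pred orbT.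
lia.
Qed.

Lemma in_span_Pcoef sh t b a u c :
    (t <= s)%N -> (b <= t)%N -> (b <= a)%N -> (0 < u)%N -> quasi_const p b c ->
  in_span sh t (fun k => c * ((p ^ (s - b))%:R * Pcoef p a sh (u * p ^ b).-1 k)).
Proof.
move=> ts; have [m] := ubnP b; elim: m b a u c => // m IH b a u c bm bt ba u0 qc.
(* For [b = 0] the scalar is [p ^ s] itself, so the vector vanishes modulo [p ^ s]. *)
have [->|b0] := posnP b.
  apply: in_span_ext (in_span_pM sh t (fun k => c * Pcoef p a sh (u * p ^ 0).-1 k)).
  by move=> k; rewrite subn0 mulrCA.
have [|G EG] := @Phi_quot_pow sh a b; first by rewrite b0.
have ub0 : (0 < u * p ^ b)%N by rewrite muln_gt0 u0 expn_gt0 prime_gt0.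
pose F j k := c * ((p ^ (s - b))%:R *
  ((Phi_quot p b sh k)`_((u * p ^ b).-1 - j) * (G ^+ (p ^ b))`_j)).
suff FS : forall j, j \in index_iota 0 (u * p ^ b) -> in_span sh t (F j).
  apply: in_span_ext (in_span_sum FS) => k.
  by rewrite /Pcoef EG coefMr (prednK ub0) big_mkord !mulr_sumr.
move=> j; rewrite mem_index_iota /= => jlt.
(* The [j]-th term of the convolution gains [p^(b - b')], turning [p^(s - b)] into [p^(s - b')],
   while its index plus one stays a multiple of [p^b']. *)
have [b' [h [bb gE Eh qh]]] := coef_pow_pfactor b G j.
have [v Ev] : exists v, (u * p ^ b - j = v * p ^ b')%N.
  apply/dvdnP; apply: dvdn_sub; first by rewrite dvdn_mull // dvdn_exp2l.
  by rewrite -gE dvdn_gcdl.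
have v0 : (0 < v)%N by case: v Ev => [|v]; lia.
have qch : quasi_const p b' (c * h) by apply: quasi_constM => //; apply: quasi_constW qc.
have EF k : F j k =
    c * h * ((p ^ (s - b'))%:R * Pcoef p b sh (v * p ^ b').-1 k).
  rewrite /F Eh -Ev /Pcoef; have -> : (s - b' = (s - b) + (b - b'))%N by lia.
  have -> : ((u * p ^ b).-1 - j = (u * p ^ b - j).-1)%N by lia.
  by rewrite expnD natrM; ring.
apply: (in_span_ext (fun k => esym (EF k))).
(* If [b' < b], induction applies with [b] in the role of [a]; if [b' = b], the term is a multiple
   of a generator, or zero when [v > g]. *)
have [Eb|nb] := eqVneq b' b; last by apply: IH => //; lia.
rewrite Eb in qch *; have [vg|gv] := leqP v g.
  by apply: in_span_gen => //; apply/andP.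
apply: in_span_ext (in_span0 sh t) => k.
by rewrite Pcoef_eq0 // !mulr0.
Qed.

(** * Change of the base point by Taylor expansion *)

Lemma Phi_quot_shift r sh sh' k :
  Phi_quot p r sh' k = Phi_quot p r sh k \Po ('X + (sh' - sh)%:P).
Proof.
rewrite /Phi_quot rmorph_prod; apply: eq_bigr => i _.
rewrite rmorphXn /= comp_polyD comp_polyX comp_polyC -addrA -polyCD.
by rewrite (addrA (sh' - sh)) subrK.
Qed.

Lemma coef_comp_XaddC (A : comNzRingType) (q : {poly A}) (y : A) j :
  (q \Po ('X + y%:P))`_j
  = \sum_(0 <= m < size q) q`_m * ('C(m, j)%:R * y ^+ (m - j)).
Proof.
rewrite comp_polyE coef_sum big_mkord; apply: eq_bigr => m _.
rewrite coefZ addrC exprDn coef_sum; congr (_ * _).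
have [jm|mj] := ltnP j m.+1; last first.
  rewrite bin_small // mul0r big1 // => i _; rewrite coefMn -polyC_exp coefCM.
  by rewrite coefXn gtn_eqF ?mulr0 ?mul0rn //; have := ltn_ord i; lia.
rewrite (bigD1 (Ordinal jm)) //= big1 ?addr0 => [|i ij].
  by rewrite coefMn -polyC_exp coefCM coefXn eqxx mulr1 mulr_natl.
rewrite coefMn -polyC_exp coefCM coefXn [_ == _](_ : _ = false) ?mulr0 ?mul0rn //.
by apply: contraNF ij => /eqP E; apply/eqP/val_inj.
Qed.

Lemma in_span_shift sh sh' t r l c :
    (t <= s)%N -> (1 <= r <= t)%N -> (0 < l)%N -> quasi_const p r c ->
  in_span sh t (fun k => c * ((p ^ (s - r))%:R * Pcoef p r sh' (l * p ^ r).-1 k)).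
Proof.
move=> ts /andP[r0 rt] l0 qc; set K := (l * p ^ r)%N.
have K0 : (0 < K)%N by rewrite muln_gt0 l0 expn_gt0 prime_gt0.
pose F m k := c * ((p ^ (s - r))%:R *
  ((Phi_quot p r sh k)`_m * ('C(m, K.-1)%:R * (sh' - sh) ^+ (m - K.-1)))).
(* A bound common to all components lets one sum over [m] describe the whole vector. *)
pose N := (\max_(k < n) size (Phi_quot p r sh k))%N.
suff FS : forall m, m \in index_iota 0 N -> in_span sh t (F m).
  apply: in_span_ext (in_span_sum FS) => k.
  rewrite /Pcoef (Phi_quot_shift _ sh) coef_comp_XaddC !mulr_sumr.
  have sN : (size (Phi_quot p r sh k) <= N)%N by apply: (leq_bigmax k).
  rewrite (big_cat_nat (leq0n _) sN) //= [X in _ + X]big_nat_cond [X in _ + X]big1 ?addr0 //.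
  by move=> m /andP[/andP[sm _] _]; rewrite /F nth_default // mul0r !mulr0.
move=> m _; have [mK|Km] := ltnP m K.-1.
  by apply: in_span_ext (in_span0 sh t) => k; rewrite /F bin_small // mul0r !mulr0.
have [|b [h [br gE Eh]]] := @mpoly_gauss n p r m.+1 'C(m, K.-1)%:R pp.
  (* [(m + 1) C(m, K - 1) = K C(m + 1, K)] with [K = l p^r]. *)
  exists (l%:R * 'C(m.+1, K)%:R); rewrite -!natrM; congr (_%:R).
  by rewrite (mul_bin_diag m.+1) prednK // mulnA (mulnC (p ^ r)%N).
have [v Ev] : exists v, m.+1 = (v * p ^ b)%N.
  by apply/dvdnP; rewrite -gE dvdn_gcdl.
have v0 : (0 < v)%N by case: v Ev.
have qh : quasi_const p b h.
  (* The product [p^(r - b) h] is an integer constant, so its derivatives vanish. *)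
  apply: (@quasi_const_div _ p r b) => //; rewrite -Eh.
  by apply/quasi_constP => i; exists 0; rewrite mulr0 -mpolyC_nat mderivC.
have qch : quasi_const p b (c * (h * (sh' - sh) ^+ (m - K.-1))).
  apply: quasi_constM; first exact: quasi_constW qc.
  apply: quasi_constM => //; apply: quasi_constX.
  (* Both [m + 1] and [K] are multiples of [p ^ b], hence so is the exponent of [sh' - sh]. *)
  have -> : (m - K.-1 = m.+1 - K)%N by lia.
  by apply: dvdn_sub; [rewrite Ev dvdn_mull|rewrite dvdn_mull // dvdn_exp2l].
apply: in_span_ext (in_span_Pcoef (a := r) sh ts _ _ v0 qch) => [k||] //;
  last exact: leq_trans rt.
rewrite /F Eh /Pcoef -Ev; have -> : (s - b = (s - r) + (r - b))%N by lia.
by rewrite expnD natrM; ring.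
Qed.

Lemma Mset_shift sh sh' t V : (t <= s)%N -> (1 < p ^ s)%N ->
  Mset p g s t sh' V -> Mset p g s t sh V.
Proof.
move=> ts ps [c [qc EV]].
pose W k := \sum_(1 <= r < t.+1) \sum_(1 <= l < g.+1)
  c r l * ((p ^ (s - r))%:R * Pcoef p r sh' (l * p ^ r).-1 k).
have [c' [E [qc' EW]]] : in_span sh t W.
  apply: in_span_sum => r; rewrite mem_index_iota => rt.
  apply: in_span_sum => l; rewrite mem_index_iota => lg.
  by case/andP: (lg) => l0 _; apply: in_span_shift => //; apply: qc.
exists c'; split=> [r l _ _|k]; first exact: qc'.
have -> : V k = red (p ^ s) (W k) by exact: EV.
by rewrite EW redD (red_modulus _ ps) addr0.
Qed.

End Span.

Unset Implicit Arguments.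

Theorem theorem9p1 (p g : nat) :
  prime p -> odd p -> (1 <= g)%N -> ((2 * g).+1 < p)%N ->
  forall s : nat, (1 <= s)%N ->
    (forall l : nat, (1 <= l)%N ->
       KZ_sol_mod (p ^ s) (Pcoef p s (zlast g) (l * p ^ s).-1))
    /\
    (forall t : nat, (1 <= t <= s)%N ->
       forall V : 'I_(2 * g).+1 -> {mpoly 'Z_(p ^ s)[(2 * g).+1]},
         Mset p g s t (zlast g) V <-> Mset p g s t 0 V).
Proof.
move=> pp op _ _ s s0.
have ps1 : (1 < p ^ s)%N by rewrite -{1}(exp1n s) ltn_exp2r ?prime_gt1.
split=> [l l0|t /andP[_ ts] V]; first exact: Pcoef_KZ_mod.
by split; apply: Mset_shift.
Qed.
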